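(* Let $A$ be a commutative $\mathbf k$-algebra with product $\cdot$. The bialgebra $(\mathrm{QS}(A),\ast,1_{\mathbf k},\Delta,\epsilon)$ (quasi-shuffle product, deconcatenation coproduct) is a Hopf algebra whose antipode $S$ is the linear map given on pure tensors $\mathbf a=a_1\otimes\cdots\otimes a_n$ by $$S(\mathbf a)=(-1)^{n}\sum_{L\models n}L\circ\mathbf a^r,$$ where the sum runs over all compositions $L$ of $n=\ell(\mathbf a)$, with the convention $S(1_{\mathbf k})=1_{\mathbf k}$.
   Context: $\mathbf k$ is a commutative unitary ring containing $\mathbb Q$; algebras are unitary and associative; tensor products are over $\mathbf k$. $\mathrm{QS}(A)$ is the $\mathbf k$-module $T(A)=\bigoplus_{n\ge0}A^{\otimes n}$ (with $A^{\otimes 0}=\mathbf k$) with the quasi-shuffle product $\ast$ defined recursively by $1_{\mathbf k}\ast\mathbf a=\mathbf a=\mathbf a\ast1_{\mathbf k}$ and, for $a,b\in A$ and pure tensors $\mathbf a,\mathbf b\in T(A)$, $$(a\otimes\mathbf a)\ast(b\otimes\mathbf b)=a\otimes(\mathbf a\ast(b\otimes\mathbf b))+b\otimes((a\otimes\mathbf a)\ast\mathbf b)+(a\cdot b)\otimes(\mathbf a\ast\mathbf b)$$ (here $a\otimes 1_{\mathbf k}$ means $a$). The coproduct is deconcatenation, $\Delta(a_1\otimes\cdots\otimes a_n)=\sum_{i=0}^n(a_1\otimes\cdots\otimes a_i)\otimes(a_{i+1}\otimes\cdots\otimes a_n)\in \mathrm{QS}(A)\otimes \mathrm{QS}(A)$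 (empty tensors being $1_{\mathbf k}$), and the counit $\epsilon$ is the projection onto $A^{\otimes0}=\mathbf k$. A composition $L=(\ell_1,\dots,\ell_k)$ of $n$, written $L\models n$, is a tuple of positive integers with sum $n$. For $\mathbf a=a_1\otimes\cdots\otimes a_n$: the length is $\ell(\mathbf a)=n$; the reversal is $\mathbf a^r=a_n\otimes\cdots\otimes a_1$; and $L\circ\mathbf a=(a_1\cdots a_{\ell_1})\otimes(a_{\ell_1+1}\cdots a_{\ell_1+\ell_2})\otimes\cdots\otimes(a_{\ell_1+\cdots+\ell_{k-1}+1}\cdots a_n)$, products being taken in $A$. *)

(* Defs.v *)
From HB Require Import structures.
From mathcomp Require Import all_boot.
From mathcomp Require Import ssralg ring_quotient.
From mathcomp.classical Require Import boolp.
From mathcomp.multinomials Require Import freeg.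

Set Implicit Arguments.
Unset Strict Implicit.
Unset Printing Implicit Defensive.

Import GRing.Theory.
Local Open Scope ring_scope.
Local Open Scope quotient_scope.

Section FreeModule.
Variables (k : comNzRingType) (X : choiceType) (M : lmodType k) (f : X -> M).

Fact fglift_linear : linear (fglift f : {freeg X / k} -> M).
Proof.
move=> c x y.
have fB (u v : {freeg X / k}) : fglift f (u - v) = fglift f u - fglift f v.
  exact: lift_is_additive.
have f0 : fglift f 0 = 0.
  by rewrite -[X in fglift f X](subrr (0 : {freeg X / k})) fB subrr.
have fD (u v : {freeg X / k}) : fglift f (u + v) = fglift f u + fglift f v.
  by rewrite -[v in LHS]opprK fB -[- v]sub0r fB f0 sub0r opprK.
have fU d z : fglift f << d *g z >> = d *: f z by exact: liftU.
rewrite fD; congr (_ + _).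
rewrite -[x]freeg_sumE; elim: (dom x) => [|z s IH].
  by rewrite big_nil !(scaler0, f0).
rewrite big_cons scalerDr !fD IH scalerDr; congr (_ + _).
have -> : c *: << coeff z x *g z >> = << c * coeff z x *g z >> :> {freeg X / k}.
  by apply/eqP/freeg_eqP => w; rewrite coeffZ !coeffU mulrA.
by rewrite !fU scalerA.
Qed.
HB.instance Definition _ := GRing.isLinear.Build k {freeg X / k} M *:%R
  (fglift f) fglift_linear.

Lemma fglift_gen x : fglift f << x >> = f x.
Proof. by rewrite liftU scale1r. Qed.

Lemma fglift_rel c x y z :
  fglift f (<< x >> - c *: << y >> - << z >> : {freeg X / k}) =
    f x - c *: f y - f z.
Proof. by rewrite !linearB linearZ /= !fglift_gen. Qed.

End FreeModule.

Fact scale_swap (k : comNzRingType) (M : lmodType k) (c d : k) (x x' y y' : M) :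
  d *: (c *: x + x') + (c *: y + y') = c *: (d *: x + y) + (d *: x' + y').
Proof. by rewrite !scalerDr !scalerA (mulrC d c) addrACA. Qed.

Section Presented.
Variables (k : comNzRingType) (X : choiceType).
Local Notation F := {freeg X / k}.
Variable rel : F -> Prop.

Inductive rel_span : F -> Prop :=
| rel_span0 : rel_span 0
| rel_spanD c x y : rel x -> rel_span y -> rel_span (c *: x + y).

Definition relations : {pred F} := fun x => `[< rel_span x >].

Lemma rel_spanP x : reflect (rel_span x) (x \in relations).
Proof. exact: asboolP. Qed.

Lemma rel_span_lin c x y : rel_span x -> rel_span y -> rel_span (c *: x + y).
Proof.
move=> Hx Hy; elim: Hx => [|d u v Hu _ IH]; first by rewrite scaler0 add0r.
by rewrite scalerDr scalerA -addrA; apply: rel_spanD.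
Qed.

Lemma relations_zmod_closed : zmod_closed relations.
Proof.
split=> [|x y /rel_spanP Hx /rel_spanP Hy]; apply/rel_spanP; first exact: rel_span0.
by rewrite addrC -scaleN1r; apply: rel_span_lin.
Qed.

HB.instance Definition _ := GRing.isZmodClosed.Build F relations
  relations_zmod_closed.

Lemma relationsZ c x : x \in relations -> c *: x \in relations.
Proof.
move=> /rel_spanP Hx; apply/rel_spanP; rewrite -[_ *: _]addr0.
exact: rel_span_lin Hx rel_span0.
Qed.

Definition presented : Type := Quotient.quot relations.
HB.instance Definition _ := Choice.on presented.
HB.instance Definition _ := GRing.Zmodule.on presented.

Definition proj (x : F) : presented := \pi_(Quotient.quot relations) x.

Lemma proj_repr (u : presented) : proj (repr u) = u.
Proof. exact: reprK. Qed.

Lemma projB x y : proj (x - y) = proj x - proj y.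
Proof. exact: pi_is_zmod_morphism. Qed.

Lemma projP x y : proj x = proj y <-> x - y \in relations.
Proof.
rewrite Quotient.idealrBE; split=> [H|/eqP //]; exact/eqP.
Qed.

Lemma proj0 : proj 0 = 0.
Proof. by rewrite -[X in proj X](subrr (0 : F)) projB subrr. Qed.

Lemma projD x y : proj (x + y) = proj x + proj y.
Proof.
by rewrite -[y in LHS]opprK projB -[- y]sub0r projB proj0 sub0r opprK.
Qed.

Definition pscale (c : k) (u : presented) : presented := proj (c *: repr u).

Lemma proj_scale c x : proj (c *: x) = pscale c (proj x).
Proof.
apply/projP; rewrite -scalerBr; apply: relationsZ; apply/projP.
by rewrite proj_repr.
Qed.

Fact pscaleA a b v : pscale a (pscale b v) = pscale (a * b) v.
Proof. by rewrite -[v]proj_repr -!proj_scale scalerA. Qed.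
Fact pscale1 : left_id 1 pscale.
Proof. by move=> v; rewrite -[v]proj_repr -!proj_scale scale1r. Qed.
Fact pscaleDr : right_distributive pscale +%R.
Proof.
by move=> c u v; rewrite -[u]proj_repr -[v]proj_repr -!(projD, proj_scale) scalerDr.
Qed.
Fact pscaleDl v : {morph pscale^~ v : a b / a + b}.
Proof. by move=> a b; rewrite -[v]proj_repr -!proj_scale -projD scalerDl. Qed.

HB.instance Definition _ := GRing.Zmodule_isLmodule.Build k presented
  pscaleA pscale1 pscaleDr pscaleDl.

Lemma projZ c x : proj (c *: x) = c *: proj x.
Proof. exact: proj_scale. Qed.

Definition gen (x : X) : presented := proj << x >>.

Lemma gen_rel z : rel z -> proj z = 0.
Proof.
move=> Hz; rewrite -proj0; apply/projP; rewrite subr0.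
apply/rel_spanP; rewrite -[z]scale1r -[_ *: _]addr0.
exact: rel_spanD Hz rel_span0.
Qed.

Lemma presented_ind (P : presented -> Prop) :
    P 0 -> (forall c x u, P u -> P (c *: gen x + u)) -> forall u, P u.
Proof.
move=> P0 PD u; rewrite -[u]proj_repr -[repr u]freeg_sumE.
elim: (dom _) => [|x s IH].
  by rewrite big_nil proj0.
rewrite big_cons projD; set d := coeff _ _.
have -> : << d *g x >> = d *: << x >> :> F.
  by apply/eqP/freeg_eqP => y; rewrite coeffZ !coeffU mul1r.
by rewrite projZ; apply: PD.
Qed.

Section Lift.
Variables (M : lmodType k) (f : X -> M).

Hypothesis f_rel : forall z, rel z -> fglift f z = 0.

Definition lift_gen of (forall z, rel z -> fglift f z = 0) : presented -> M :=
  fun u => fglift f (repr u).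

Lemma lift_proj x : lift_gen f_rel (proj x) = fglift f x.
Proof.
have H : forall z, rel_span z -> fglift f z = 0.
  move=> z; elim=> [|c u v Hu _ IH]; first exact: linear0.
  by rewrite linearP /= IH f_rel // scaler0 addr0.
have /projP/rel_spanP/H := proj_repr (proj x).
by rewrite linearB /= => /eqP; rewrite subr_eq0 => /eqP.
Qed.

Fact lift_gen_linear : linear (lift_gen f_rel).
Proof.
move=> c u v; rewrite -[u]proj_repr -[v]proj_repr -projZ -projD !lift_proj.
exact: linearP.
Qed.

HB.instance Definition _ := GRing.isLinear.Build k presented M *:%R
  (lift_gen f_rel) lift_gen_linear.

Lemma lift_genE x : lift_gen f_rel (gen x) = f x.
Proof. by rewrite lift_proj fglift_gen. Qed.

End Lift.
End Presented.

(** Sealed so that conversion does not unfold the quotient; use [gen_rel],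
    [presented_ind] and [lift_genE]. *)
Global Opaque relations proj pscale gen lift_gen.

Section TensorProduct.
Variables (k : comNzRingType) (M N : lmodType k).

Inductive bilin_rel : {freeg (M * N) / k} -> Prop :=
| BilinRelL c x x' y :
    bilin_rel (<< (c *: x + x', y) >> - c *: << (x, y) >> - << (x', y) >>)
| BilinRelR c x y y' :
    bilin_rel (<< (x, c *: y + y') >> - c *: << (x, y) >> - << (x, y') >>).

Definition tensor : Type := presented bilin_rel.
HB.instance Definition _ := GRing.Lmodule.on tensor.

Definition tens (x : M) (y : N) : tensor := gen bilin_rel (x, y).

Lemma tensPl c x x' y : tens (c *: x + x') y = c *: tens x y + tens x' y.
Proof.
apply/eqP; rewrite -subr_eq0 opprD addrA -projZ -!projB; apply/eqP.
exact/gen_rel/BilinRelL.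
Qed.

Lemma tensPr c x y y' : tens x (c *: y + y') = c *: tens x y + tens x y'.
Proof.
apply/eqP; rewrite -subr_eq0 opprD addrA -projZ -!projB; apply/eqP.
exact/gen_rel/BilinRelR.
Qed.

Lemma tens_ind (P : tensor -> Prop) :
  P 0 -> (forall c x y u, P u -> P (c *: tens x y + u)) -> forall u, P u.
Proof. by move=> P0 PD; apply: presented_ind => // c [x y] u; apply: PD. Qed.

Definition bilinear (P : lmodType k) (b : M -> N -> P) : Prop :=
  (forall c x x' y, b (c *: x + x') y = c *: b x y + b x' y) /\
  (forall c x y y', b x (c *: y + y') = c *: b x y + b x y').

Section Lift.
Variables (P : lmodType k) (b : M -> N -> P) (b_bilin : bilinear b).

Fact bilin_lift_subproof z :
  bilin_rel z -> fglift (fun p : M * N => b p.1 p.2) z = 0.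
Proof.
case: b_bilin => bl br [c x x' y | c x y y']; rewrite fglift_rel /=.
  by rewrite bl -addrA -opprD subrr.
by rewrite br -addrA -opprD subrr.
Qed.

Definition tens_lift : {linear tensor -> P} := lift_gen bilin_lift_subproof.

Lemma tens_liftE x y : tens_lift (tens x y) = b x y.
Proof. exact: lift_genE. Qed.

Lemma tens_liftP c x y u :
  tens_lift (c *: tens x y + u) = c *: b x y + tens_lift u.
Proof. by rewrite linearP tens_liftE. Qed.

End Lift.

Lemma tens_linear_ext (P : lmodType k) (f g : {linear tensor -> P}) :
  (forall x y, f (tens x y) = g (tens x y)) -> f =1 g.
Proof.
move=> fg; apply: tens_ind => [|c x y u IH]; first by rewrite !linear0.
by rewrite !linearP fg IH.
Qed.

End TensorProduct.

Notation "M ⊗ N" := (tensor M N) (at level 40, left associativity) : type_scope.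
Notation "x ⊗ y" := (tens x y) (at level 40, left associativity) : ring_scope.

Section TensorMaps.
Variable k : comNzRingType.

Section Map.
Variables (M N M' N' : lmodType k).
Variables (f : {linear M -> M'}) (g : {linear N -> N'}).

Fact tens_map_bilin : bilinear (fun x y => f x ⊗ g y).
Proof.
by split=> *; rewrite linearP ?tensPl ?tensPr.
Qed.

Definition tens_map : {linear (M ⊗ N)%type -> (M' ⊗ N')%type} :=
  tens_lift tens_map_bilin.

Lemma tens_mapE x y : tens_map (x ⊗ y) = f x ⊗ g y.
Proof. exact: tens_liftE. Qed.

Lemma tens_mapP c x y u :
  tens_map (c *: (x ⊗ y) + u) = c *: (f x ⊗ g y) + tens_map u.
Proof. exact: tens_liftP. Qed.

End Map.

Section Assoc.
Variables (M N P : lmodType k).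

Fact tens_assoc_row_bilin (x : M) :
  bilinear (fun (y : N) (z : P) => (x ⊗ y) ⊗ z).
Proof. by split=> *; rewrite ?tensPr ?tensPl. Qed.

Fact tens_assoc_bilin :
  bilinear (fun (x : M) => tens_lift (tens_assoc_row_bilin x)).
Proof.
split=> [c x x' u|c x u v]; last by rewrite linearP.
elim/tens_ind: u => [|d y z u IH]; first by rewrite !linear0 ?scaler0 addr0.
by rewrite !tens_liftP IH !tensPl scale_swap.
Qed.

Definition tens_assoc : {linear (M ⊗ (N ⊗ P))%type -> (M ⊗ N ⊗ P)%type} :=
  tens_lift tens_assoc_bilin.

Lemma tens_assocE x y z : tens_assoc (x ⊗ (y ⊗ z)) = x ⊗ y ⊗ z.
Proof. by rewrite /tens_assoc !tens_liftE. Qed.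

End Assoc.

Section Unit.
Variable M : lmodType k.

Fact tens_unitl_bilin : bilinear (fun (c : k^o) (x : M) => (c : k) *: x).
Proof.
split=> [c a b x|c a x y]; first by rewrite scalerDl scalerA.
by rewrite scalerDr !scalerA mulrC.
Qed.

Fact tens_unitr_bilin : bilinear (fun (x : M) (c : k^o) => (c : k) *: x).
Proof. by case: tens_unitl_bilin => ? ?; split=> *. Qed.

Definition tens_unitl : {linear (k^o ⊗ M)%type -> M} :=
  tens_lift tens_unitl_bilin.
Definition tens_unitr : {linear (M ⊗ k^o)%type -> M} :=
  tens_lift tens_unitr_bilin.

Lemma tens_unitlE c x : tens_unitl (c ⊗ x) = (c : k) *: x.
Proof. exact: tens_liftE. Qed.

Lemma tens_unitrE c x : tens_unitr (x ⊗ c) = (c : k) *: x.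
Proof. exact: tens_liftE. Qed.

End Unit.

Section Square.
Variables (H : lmodType k) (mu : {linear (H ⊗ H)%type -> H}).

Definition mulL (x y : H) : H := mu (x ⊗ y).

Fact mulL_linear x : linear (mulL x).
Proof. by move=> c y z; rewrite /mulL tensPr linearP. Qed.
HB.instance Definition _ x := GRing.isLinear.Build k H H *:%R (mulL x)
  (mulL_linear x).

Lemma mulLP c x x' y : mulL (c *: x + x') y = c *: mulL x y + mulL x' y.
Proof. by rewrite /mulL tensPl linearP. Qed.

Fact tens_mul_row_bilin (w : H ⊗ H) :
  bilinear (fun x y : H => tens_map (mulL x) (mulL y) w).
Proof.
split=> [c x x' y|c x y y']; elim/tens_ind: w => [|d a b w IH];
  rewrite ?linear0 ?scaler0 ?addr0 // !tens_mapP IH.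
  by rewrite /= mulLP tensPl scale_swap.
by rewrite /= mulLP tensPr scale_swap.
Qed.

(** The product [(x ⊗ y)(a ⊗ b) = xa ⊗ yb] of the algebra [H ⊗ H]. *)
Definition tens_mul (u w : H ⊗ H) : H ⊗ H := tens_lift (tens_mul_row_bilin w) u.

Lemma tens_mulE x y a b :
  tens_mul (x ⊗ y) (a ⊗ b) = mu (x ⊗ a) ⊗ mu (y ⊗ b).
Proof. by rewrite /tens_mul tens_liftE tens_mapE. Qed.

Lemma tens_mulPl c u u' w :
  tens_mul (c *: u + u') w = c *: tens_mul u w + tens_mul u' w.
Proof. exact: linearP. Qed.

Lemma tens_mulPr c u w w' :
  tens_mul u (c *: w + w') = c *: tens_mul u w + tens_mul u w'.
Proof.
elim/tens_ind: u => [|d x y u IH].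
  by rewrite /tens_mul !linear0 ?scaler0 addr0.
rewrite !tens_mulPl IH -scale_swap; congr (_ *: _ + _).
by rewrite /tens_mul !tens_liftE; apply: linearP.
Qed.

End Square.

End TensorMaps.

Section Hopf.
Variables (k : comNzRingType) (H : lmodType k).
Variables (mu : {linear (H ⊗ H)%type -> H}) (one : H).
Variables (Delta : {linear H -> (H ⊗ H)%type}) (eps : {linear H -> k^o}).

Record is_bialgebra : Prop := IsBialgebra {
  bialg_mulA : forall x y z, mu (x ⊗ mu (y ⊗ z)) = mu (mu (x ⊗ y) ⊗ z);
  bialg_1mul : forall x, mu (one ⊗ x) = x;
  bialg_mul1 : forall x, mu (x ⊗ one) = x;
  bialg_coassoc : forall x,
    tens_map Delta idfun (Delta x) =
      tens_assoc _ _ _ (tens_map idfun Delta (Delta x));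
  bialg_counitl : forall x, tens_unitl _ (tens_map eps idfun (Delta x)) = x;
  bialg_counitr : forall x, tens_unitr _ (tens_map idfun eps (Delta x)) = x;
  bialg_Delta_mul : forall x y,
    Delta (mu (x ⊗ y)) = tens_mul mu (Delta x) (Delta y);
  bialg_Delta1 : Delta one = one ⊗ one;
  bialg_eps_mul : forall x y, eps (mu (x ⊗ y)) = (eps x : k) * (eps y : k);
  bialg_eps1 : eps one = (1 : k)
}.

Definition is_antipode (S : {linear H -> H}) : Prop :=
  forall x, mu (tens_map S idfun (Delta x)) = (eps x : k) *: one /\
            mu (tens_map idfun S (Delta x)) = (eps x : k) *: one.

Definition is_hopf_algebra (S : {linear H -> H}) : Prop :=
  is_bialgebra /\ is_antipode S.

End Hopf.

Section TensorAlgebra.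
Variables (k : comNzRingType) (V : lmodType k).

Inductive multilin_rel : {freeg (seq V) / k} -> Prop :=
| MultilinRel c (s : seq V) a b t :
    multilin_rel (<< s ++ (c *: a + b) :: t >>
                  - c *: << s ++ a :: t >> - << s ++ b :: t >>).

(** The relations only involve words of one common length, so this module is
    the direct sum over [n] of the modules generated by the words of length [n],
    and these are the tensor powers [V^{⊗n}]; for [n = 0] there is no relation
    and one generator, the empty word. *)
Definition tmod : Type := presented multilin_rel.
HB.instance Definition _ := GRing.Lmodule.on tmod.

(** The pure tensor [a_1 ⊗ ... ⊗ a_n]; [word [::]] is [1_k]. *)
Definition word (s : seq V) : tmod := gen multilin_rel s.

Definition multilinear (M : lmodType k) (f : seq V -> M) : Prop :=
  forall c s a b t,
    f (s ++ (c *: a + b) :: t) = c *: f (s ++ a :: t) + f (s ++ b :: t).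

Lemma word_multilinear : multilinear word.
Proof.
move=> c s a b t; apply/eqP.
rewrite -subr_eq0 opprD addrA -projZ -!projB; apply/eqP.
exact/gen_rel/MultilinRel.
Qed.

Lemma tmod_ind (P : tmod -> Prop) :
  P 0 -> (forall c s u, P u -> P (c *: word s + u)) -> forall u, P u.
Proof. exact: presented_ind. Qed.

Section Lift.
Variables (M : lmodType k) (f : seq V -> M) (f_multilin : multilinear f).

Fact word_lift_subproof z : multilin_rel z -> fglift f z = 0.
Proof. by case=> c s a b t; rewrite fglift_rel f_multilin -addrA -opprD subrr. Qed.

(** The linear map [T(V) -> M] induced by a function on pure tensors that is
    multilinear in each length. *)
Definition word_lift : {linear tmod -> M} := lift_gen word_lift_subproof.

Lemma word_liftE s : word_lift (word s) = f s.
Proof. exact: lift_genE. Qed.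

Lemma word_liftP c s u : word_lift (c *: word s + u) = c *: f s + word_lift u.
Proof. by rewrite linearP word_liftE. Qed.

End Lift.

Lemma tmod_linear_ext (M : lmodType k) (f g : {linear tmod -> M}) :
  (forall s, f (word s) = g (word s)) -> f =1 g.
Proof.
move=> fg; apply: tmod_ind => [|c s u IH]; first by rewrite !linear0.
by rewrite !linearP fg IH.
Qed.

Fact cons_multilinear (a : V) : multilinear (fun s => word (a :: s)).
Proof. by move=> c s b b' t; rewrite -!cat_cons word_multilinear. Qed.

(** [a ⊗ -], prefixing a letter. *)
Definition wcons (a : V) : {linear tmod -> tmod} :=
  word_lift (cons_multilinear a).

Lemma wconsE a s : wcons a (word s) = word (a :: s).
Proof. exact: word_liftE. Qed.

Lemma wconsP c a b u : wcons (c *: a + b) u = c *: wcons a u + wcons b u.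
Proof.
elim/tmod_ind: u => [|d s u IH]; first by rewrite !linear0 ?scaler0 addr0.
by rewrite !word_liftP IH (word_multilinear c [::]) scale_swap.
Qed.

Definition deconc (s : seq V) : tmod ⊗ tmod :=
  \sum_(i < (size s).+1) word (take i s) ⊗ word (drop i s).

Fact deconc_multilinear : multilinear deconc.
Proof.
move=> c s a b t; rewrite /deconc !size_cat /= scaler_sumr -big_split /=.
apply: eq_bigr => i _; have [le_is | lt_si] := leqP i (size s).
  rewrite !takel_cat // !drop_cat; case: ltngtP le_is => // [_ _|-> _].
    by rewrite word_multilinear tensPr.
  by rewrite subnn !drop0 (word_multilinear c [::]) tensPr.
rewrite !take_cat !drop_cat ltnNge ltnW //=.
have [j ->] : exists j, (i - size s = j.+1)%N.
  by exists (i - size s).-1; rewrite prednK // subn_gt0.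
by rewrite /= word_multilinear tensPl.
Qed.

Definition coproduct : {linear tmod -> (tmod ⊗ tmod)%type} :=
  word_lift deconc_multilinear.

Lemma coproductE s : coproduct (word s) =
  \sum_(i < (size s).+1) word (take i s) ⊗ word (drop i s).
Proof. exact: word_liftE. Qed.

Fact counit_multilinear : multilinear (fun s : seq V => (nilp s)%:R : k^o).
Proof. by move=> c [|? s] a b t; rewrite /= scaler0 addr0. Qed.

Definition counit : {linear tmod -> k^o} := word_lift counit_multilinear.

Lemma counitE s : counit (word s) = (nilp s)%:R.
Proof. exact: word_liftE. Qed.

End TensorAlgebra.

(** A commutative [k]-algebra is a commutative ring [A] with a ring morphism
    [rho : k -> A]. The bundled [comAlgType k] is not used because it excludes
    the zero ring. *)
Section Algebra.
Variables (k : comNzRingType) (A : comPzRingType) (rho : {rmorphism k -> A}).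

Definition alg_of (_ : {rmorphism k -> A}) : Type := A.
Local Notation Ar := (alg_of rho).
HB.instance Definition _ := GRing.ComPzRing.on Ar.

Definition alg_scale (c : k) (a : Ar) : Ar := (rho c : Ar) * a.

Fact alg_scaleA c d a : alg_scale c (alg_scale d a) = alg_scale (c * d) a.
Proof. by rewrite /alg_scale (rmorphM rho) mulrA. Qed.
Fact alg_scale1 : left_id 1 alg_scale.
Proof. by move=> a; rewrite /alg_scale (rmorph1 rho) mul1r. Qed.
Fact alg_scaleDr : right_distributive alg_scale +%R.
Proof. by move=> c a b; rewrite /alg_scale mulrDr. Qed.
Fact alg_scaleDl a : {morph alg_scale^~ a : c d / c + d}.
Proof. by move=> c d; rewrite /alg_scale (rmorphD rho) mulrDl. Qed.

HB.instance Definition _ := GRing.Zmodule_isLmodule.Build k Ar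
  alg_scaleA alg_scale1 alg_scaleDr alg_scaleDl.

Lemma alg_scaleAl (c : k) (a b : Ar) : c *: (a * b) = (c *: a) * b.
Proof. exact: mulrA. Qed.

End Algebra.

Section QuasiShuffle.
Variables (k : comNzRingType) (A : comPzRingType) (rho : {rmorphism k -> A}).
Local Notation Ar := (alg_of rho).

Local Notation QS := (tmod Ar).

Fixpoint qshuffle (s t : seq Ar) {struct s} : QS :=
  if s is a :: s' then
    (fix qshuffle_s (t : seq Ar) : QS :=
      if t is b :: t' then
        wcons a (qshuffle s' t) + wcons b (qshuffle_s t')
          + wcons (a * b) (qshuffle s' t')
      else word s) t
  else word t.

Lemma qshuffle0s t : qshuffle [::] t = word t.
Proof. by []. Qed.

Lemma qshuffles0 s : qshuffle s [::] = word s.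
Proof. by case: s. Qed.

Lemma qshuffle_cons a s b t : qshuffle (a :: s) (b :: t) =
  wcons a (qshuffle s (b :: t)) + wcons b (qshuffle (a :: s) t)
    + wcons (a * b) (qshuffle s t).
Proof. by []. Qed.

Lemma qshuffleC s t : qshuffle s t = qshuffle t s.
Proof.
elim: s t => [|a s IHs] t; first by rewrite qshuffles0.
elim: t => [|b t IHt]; first by rewrite qshuffles0.
by rewrite !qshuffle_cons IHt !IHs mulrC (addrC (wcons a _)).
Qed.

Lemma qshuffle_multilinearl t : multilinear (qshuffle^~ t).
Proof.
have shuf3 (c : k) (x y z x' y' z' : QS) : c *: x + x' + (c *: y + y') +
    (c *: z + z') = c *: (x + y + z) + (x' + y' + z').
  by rewrite !scalerDr (addrACA (c *: x)) (addrACA (c *: x + c *: y)).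
move=> c s a b q; elim: s t => [|d s IHs]; elim=> [|e t IHt].
- by rewrite !qshuffles0 (word_multilinear c [::]).
- rewrite !cat0s !qshuffle_cons; rewrite !cat0s in IHt.
  rewrite IHt [X in _ + X + _ = _]linearP wconsP mulrDl -alg_scaleAl wconsP.
  exact: shuf3.
- by rewrite !qshuffles0 word_multilinear.
rewrite !cat_cons !qshuffle_cons -!cat_cons IHt !IHs.
rewrite [X in X + _ + _ = _]linearP [X in _ + X + _ = _]linearP.
by rewrite [X in _ + _ + X = _]linearP; apply: shuf3.
Qed.

Lemma qshuffle_multilinearr s : multilinear (qshuffle s).
Proof.
move=> c p a b q; rewrite ![qshuffle s _]qshuffleC.
exact: qshuffle_multilinearl.
Qed.

Fact qs_mul_row_multilinear (y : QS) :
  multilinear (fun s => word_lift (qshuffle_multilinearr s) y).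
Proof.
move=> c s a b t; elim/tmod_ind: y => [|d w u IH].
  by rewrite !linear0 ?scaler0 addr0.
by rewrite !word_liftP IH qshuffle_multilinearl scale_swap.
Qed.

Fact qs_mul_bilin :
  bilinear (fun x y : QS => word_lift (qs_mul_row_multilinear y) x).
Proof.
split=> [c x x' y|c x y y']; first by rewrite linearP.
elim/tmod_ind: x => [|d s u IH]; first by rewrite !linear0 ?scaler0 addr0.
rewrite !word_liftP IH -scale_swap; congr (_ *: _ + _).
exact: linearP.
Qed.

Definition qs_mul : {linear (QS ⊗ QS)%type -> QS} := tens_lift qs_mul_bilin.

Lemma qs_mulE s t : qs_mul (word s ⊗ word t) = qshuffle s t.
Proof. by rewrite /qs_mul tens_liftE !word_liftE. Qed.

Definition qs_one : QS := word [::].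
Definition qs_coproduct : {linear QS -> (QS ⊗ QS)%type} := coproduct Ar.
Definition qs_counit : {linear QS -> k^o} := counit Ar.

Definition pure_tensor (a : seq A) : QS := word (a : seq Ar).

End QuasiShuffle.

Notation QS rho := (tmod (alg_of rho)).

Definition is_composition (n : nat) (L : seq nat) : bool :=
  all (leq 1) L && (sumn L == n).

(** Every composition of [n] has at most [n] parts, all at most [n], so the
    finite type [{bseq n of 'I_n.+1}] contains all of them. *)
Definition compositions (n : nat) : seq (seq nat) :=
  [seq L <- [seq map val (L : seq 'I_n.+1) | L : {bseq n of 'I_n.+1}]
     | is_composition n L].

Lemma mem_compositions n L : (L \in compositions n) = is_composition n L.
Proof.
rewrite mem_filter andb_idr // => /andP[Lpos /eqP sumL].
have szL : size L <= n.
  rewrite -sumL; elim: L Lpos {sumL} => //= l L IH /andP[l0 /IH].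
  by move=> h; rewrite -add1n leq_add.
have leL l : l \in L -> l < n.+1.
  rewrite ltnS -sumL; elim: L {Lpos sumL szL} => //= m L IH.
  rewrite inE => /predU1P[->|/IH h]; first exact: leq_addr.
  exact: leq_trans h (leq_addl _ _).
have szL' : size (map (fun l => inord l : 'I_n.+1) L) <= n by rewrite size_map.
apply/mapP; exists (Bseq szL'); first by rewrite mem_enum.
rewrite /= -map_comp map_id_in // => l /leL lt_l.
by rewrite /= inordK.
Qed.

Lemma uniq_compositions n : uniq (compositions n).
Proof.
apply: filter_uniq; rewrite map_inj_uniq ?enum_uniq // => L M eqLM.
by apply/val_inj/(inj_map val_inj).
Qed.

(** [L ∘ a]: the product of each of the consecutive blocks of [a] of sizes
    given by [L]. *)
Definition comp_act (A : comPzRingType) (L : seq nat) (a : seq A) : seq A :=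
  [seq \prod_(x <- block) x | block <- reshape L a].

(* Main.v *)
(** The bialgebra axioms are checked on words by induction on the first letter,
    with [Delta (a x) = 1 ⊗ a x + (a ⊗ 1) Delta x].  Write [T s] for the sum of
    [L ∘ s] over all compositions [L].  In the alternating sum of the products
    [T (s_i ... s_1) * (s_(i+1) ... s_n)], the first letter of a term comes
    either from the left factor alone, or involves [s_(i+1)]; the terms of the
    second kind at [i] are exactly those of the first kind at [i + 1], so the
    sum telescopes to [0] and the stated [S] is a left convolution inverse of
    the identity.  As [S 1 = 1], an induction on length turns it into a two-sided
    one. *)

Require Import Defs.
From mathcomp Require Import all_boot.
From mathcomp Require Import ssralg rat.

Set Implicit Arguments.
Unset Strict Implicit.
Unset Printing Implicit Defensive.

Import GRing.Theory.
Local Open Scope ring_scope.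

(* Unlike [linearP], this leaves no redex behind: simplifying with [/=] would
   expose the quotients underlying the maps of [Defs]. *)
Lemma linP (R : pzSemiRingType) (U V : lSemiModType R) (f : {linear U -> V})
  c x y : f (c *: x + y) = c *: f x + f y.
Proof. by rewrite linearD linearZ. Qed.

(** Lets a linear combination pass through the three-term quasi-shuffle recursion. *)
Lemma scale_add3 (R : pzSemiRingType) (V : lSemiModType R) d
    (u v w u' v' w' : V) :
  d *: (u + v + w) + (u' + v' + w') =
  d *: u + u' + (d *: v + v') + (d *: w + w').
Proof. by rewrite !scalerDr (addrACA (d *: u)) (addrACA (d *: u + d *: v)). Qed.

(** * Arithmetic of pure tensors *)

Section TensorArith.
Variables (k : comNzRingType) (M N : lmodType k).
Implicit Types (x : M) (y : N).

Lemma tensDl x x' y : (x + x') ⊗ y = x ⊗ y + x' ⊗ y.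
Proof. by have := tensPl 1 x x' y; rewrite !scale1r. Qed.

Lemma tensDr x y y' : x ⊗ (y + y') = x ⊗ y + x ⊗ y'.
Proof. by have := tensPr 1 x y y'; rewrite !scale1r. Qed.

Lemma tens0l y : (0 : M) ⊗ y = 0.
Proof. by apply: (addrI (0 ⊗ y)); rewrite -tensDl !addr0. Qed.

Lemma tens0r x : x ⊗ (0 : N) = 0.
Proof. by apply: (addrI (x ⊗ 0)); rewrite -tensDr !addr0. Qed.

Lemma tensZl c x y : (c *: x) ⊗ y = c *: (x ⊗ y).
Proof. by have := tensPl c x 0 y; rewrite tens0l !addr0. Qed.

Lemma tensZr c x y : x ⊗ (c *: y) = c *: (x ⊗ y).
Proof. by have := tensPr c x y 0; rewrite tens0r !addr0. Qed.

End TensorArith.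

Section QuasiShuffleBialgebra.
Variables (k : comNzRingType) (A : comPzRingType) (rho : {rmorphism k -> A}).
Local Notation Ar := (alg_of rho).
Local Notation QS := (tmod Ar).
Local Notation mu := (qs_mul rho).
Local Notation one := (qs_one rho).
Local Notation Delta := (qs_coproduct rho).
Local Notation eps := (qs_counit rho).
Local Notation "x ⋆ y" := (mu (x ⊗ y)) (at level 40, left associativity).
Implicit Types (a b c : Ar) (s t : seq Ar) (x y z : QS).

(** * Commutativity, unit and associativity of the quasi-shuffle product *)

Lemma qsDl x x' y : (x + x') ⋆ y = x ⋆ y + x' ⋆ y.
Proof. by rewrite tensDl linearD. Qed.

Lemma qsDr x y y' : x ⋆ (y + y') = x ⋆ y + x ⋆ y'.
Proof. by rewrite tensDr linearD. Qed.

Lemma qsPl d x x' y : (d *: x + x') ⋆ y = d *: (x ⋆ y) + x' ⋆ y.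
Proof. by rewrite tensPl linP. Qed.

Lemma qsPr d x y y' : x ⋆ (d *: y + y') = d *: (x ⋆ y) + x ⋆ y'.
Proof. by rewrite tensPr linP. Qed.

Lemma qs0l x : 0 ⋆ x = 0.
Proof. by rewrite tens0l linear0. Qed.

Lemma qs0r x : x ⋆ 0 = 0.
Proof. by rewrite tens0r linear0. Qed.

Lemma qs_mulC x y : x ⋆ y = y ⋆ x.
Proof.
elim/tmod_ind: x => [|d s x IH]; first by rewrite qs0l qs0r.
rewrite qsPl qsPr IH; congr (_ *: _ + _).
elim/tmod_ind: y {IH} => [|e t y IH]; first by rewrite qs0l qs0r.
by rewrite qsPl qsPr IH !qs_mulE qshuffleC.
Qed.

Lemma qs_1mul x : one ⋆ x = x.
Proof.
elim/tmod_ind: x => [|d s x IH]; first by rewrite qs0r.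
by rewrite qsPr IH qs_mulE.
Qed.

Lemma qs_mul1 x : x ⋆ one = x.
Proof. by rewrite qs_mulC qs_1mul. Qed.

(** Both sides are bilinear in [x] and [y], so the recursion on words extends to all tensors. *)
Lemma qs_mul_wcons a x b y : wcons a x ⋆ wcons b y =
  wcons a (x ⋆ wcons b y) + wcons b (wcons a x ⋆ y) + wcons (a * b) (x ⋆ y).
Proof.
elim/tmod_ind: x => [|d s x IH].
  by rewrite !(linear0, qs0l) !addr0.
rewrite !linP !qsPl !linP IH -scale_add3; congr (_ *: _ + _).
elim/tmod_ind: y {IH} => [|e t y IH].
  by rewrite !(linear0, qs0r) !addr0.
rewrite !linP !qsPr !linP IH -scale_add3; congr (_ *: _ + _).
by rewrite !wconsE !qs_mulE qshuffle_cons.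
Qed.

(** One term for each nonempty subset of [a], [b], [c] whose product is the first letter. *)
Lemma qs_mulA_expandl a x b y c z (X := wcons a x) (Y := wcons b y)
    (Z := wcons c z) :
  X ⋆ Y ⋆ Z = wcons a (x ⋆ Y ⋆ Z) + wcons b (X ⋆ y ⋆ Z) + wcons c (X ⋆ Y ⋆ z)
    + wcons (a * b) (x ⋆ y ⋆ Z) + wcons (a * c) (x ⋆ Y ⋆ z)
    + wcons (b * c) (X ⋆ y ⋆ z) + wcons (a * b * c) (x ⋆ y ⋆ z).
Proof.
have XY := qs_mul_wcons a x b y; rewrite -/X -/Y in XY.
rewrite XY !qsDl !qs_mul_wcons !linearD.
(* Terms 2, 5 and 8, all starting with [c], make up the expansion of [wcons c (X ⋆ Y ⋆ z)]. *)
by rewrite (AC (3*3*3) (1*4*(2*5*8)*7*3*6*9)).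
Qed.

Lemma qs_mulA_expandr a x b y c z (X := wcons a x) (Y := wcons b y)
    (Z := wcons c z) :
  X ⋆ (Y ⋆ Z) = wcons a (x ⋆ (Y ⋆ Z)) + wcons b (X ⋆ (y ⋆ Z))
    + wcons c (X ⋆ (Y ⋆ z)) + wcons (a * b) (x ⋆ (y ⋆ Z))
    + wcons (a * c) (x ⋆ (Y ⋆ z)) + wcons (b * c) (X ⋆ (y ⋆ z))
    + wcons (a * b * c) (x ⋆ (y ⋆ z)).
Proof.
have YZ := qs_mul_wcons b y c z; rewrite -/Y -/Z in YZ.
rewrite YZ !qsDr !qs_mul_wcons !linearD -mulrA.
by rewrite (AC (3*3*3) ((1*4*7)*2*5*3*6*8*9)).
Qed.

(** On words, both bracketings have the same seven-term expansion; each term falls under one of the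
    three nested induction hypotheses, according to the first of the words that gets shorter. *)
Lemma qs_mulA x y z : x ⋆ (y ⋆ z) = x ⋆ y ⋆ z.
Proof.
elim/tmod_ind: x => [|d s x IH]; first by rewrite !qs0l.
rewrite !qsPl IH; congr (_ *: _ + _) => {d x IH}.
elim/tmod_ind: y => [|d t y IH]; first by rewrite qs0l !qs0r qs0l.
rewrite qsPl !qsPr qsPl IH; congr (_ *: _ + _) => {d y IH}.
elim/tmod_ind: z => [|d u z IH]; first by rewrite !qs0r.
rewrite !qsPr IH; congr (_ *: _ + _) => {d z IH}.
elim: s t u => [|a s IHs] t u; first by rewrite !qs_1mul.
elim: t u => [|b t IHt] u; first by rewrite qs_1mul qs_mul1.
elim: u => [|c u IHu]; first by rewrite !qs_mul1.
rewrite -!wconsE qs_mulA_expandl qs_mulA_expandr !wconsE.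
by rewrite IHu !IHt !IHs.
Qed.

(** * The product on the tensor square *)

Lemma tens_mul_addl u v w :
  tens_mul mu (u + v) w = tens_mul mu u w + tens_mul mu v w.
Proof. by have := tens_mulPl mu 1 u v w; rewrite !scale1r. Qed.

Lemma tens_mul_addr u v w :
  tens_mul mu u (v + w) = tens_mul mu u v + tens_mul mu u w.
Proof. by have := tens_mulPr mu 1 u v w; rewrite !scale1r. Qed.

Lemma tens_mul0l w : tens_mul mu 0 w = 0.
Proof. exact: linear0. Qed.

Lemma tens_mul0r w : tens_mul mu w 0 = 0.
Proof. by apply: (addrI (tens_mul mu w 0)); rewrite -tens_mul_addr !addr0. Qed.

(** * Coproduct and counit by recursion on the first letter *)

Definition tcons a : {linear (QS ⊗ QS)%type -> (QS ⊗ QS)%type} :=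
  tens_map (wcons a) idfun.

Lemma tconsE a x y : tcons a (x ⊗ y) = wcons a x ⊗ y.
Proof. exact: tens_mapE. Qed.

Lemma qs_coproduct1 : Delta one = one ⊗ one.
Proof. by rewrite coproductE big_ord1. Qed.

(** The cut before [a] gives the first term; every other cut leaves [a] in the left factor. *)
Lemma qs_coproduct_wcons a x :
  Delta (wcons a x) = one ⊗ wcons a x + tcons a (Delta x).
Proof.
elim/tmod_ind: x => [|d s x IH].
  by rewrite !linear0 tens0r addr0.
rewrite !linP IH tensDr tensZr addrACA -scalerDr; congr (_ *: _ + _).
rewrite wconsE !coproductE big_ord_recl /= linear_sum /=.
by congr (_ + _); apply: eq_bigr => i _; rewrite tconsE wconsE.
Qed.

Lemma qs_counit_wcons a x : eps (wcons a x) = 0.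
Proof.
elim/tmod_ind: x => [|d s x IH]; first by rewrite !linear0.
by rewrite !linP IH wconsE counitE scaler0 addr0.
Qed.

Lemma qs_counit1 : eps one = (1 : k).
Proof. by rewrite counitE. Qed.

(** [eps] kills every tensor that starts with a letter, and by the recursion a product of two
    nonempty words is a sum of such tensors. *)
Lemma qs_counit_mul x y : eps (x ⋆ y) = (eps x : k) * (eps y : k).
Proof.
elim/tmod_ind: x => [|d s x IH]; first by rewrite qs0l !linear0 mul0r.
rewrite qsPl !linP IH.
rewrite -[RHS]/((d * (eps (word s) : k) + (eps x : k)) * (eps y : k)).
rewrite mulrDl -mulrA; congr (d * _ + _) => {x IH}.
elim/tmod_ind: y => [|e t y IH]; first by rewrite qs0r !linear0 mulr0.
rewrite qsPr !linP IH.
rewrite -[RHS]/((eps (word s) : k) * (e * (eps (word t) : k) + (eps y : k))).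
rewrite mulrDr mulrCA; congr (e * _ + _) => {y IH}.
case: s => [|a s]; first by rewrite qs_1mul qs_counit1 mul1r.
case: t => [|b t]; first by rewrite qs_mul1 qs_counit1 mulr1.
by rewrite -!wconsE qs_mul_wcons !linearD !qs_counit_wcons mul0r !addr0.
Qed.

(** * Coassociativity and the counit laws *)

Lemma tens_map_coproduct_tcons a (u : QS ⊗ QS) :
  tens_map Delta idfun (tcons a u) =
  tens_assoc _ _ _ (one ⊗ tcons a u) +
    tens_map (tcons a) idfun (tens_map Delta idfun u).
Proof.
elim/tens_ind: u => [|d x y u IH].
  by rewrite !linear0 tens0r linear0 addr0.
rewrite !linP IH tensPr !linP addrACA -scalerDr; congr (_ *: _ + _).
by rewrite tconsE !tens_mapE qs_coproduct_wcons tensDl tens_assocE.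
Qed.

Lemma tens_assoc_tcons a (u : QS ⊗ QS) :
  tens_assoc _ _ _ (tens_map idfun Delta (tcons a u)) =
  tens_map (tcons a) idfun (tens_assoc _ _ _ (tens_map idfun Delta u)).
Proof.
elim/tens_ind: u => [|d x y u IH]; first by rewrite !linear0.
rewrite !linP IH; congr (_ *: _ + _); rewrite tconsE !tens_mapE.
elim/tens_ind: (Delta y) => [|e v w z IHz]; first by rewrite !(tens0r, linear0).
by rewrite !tensPr !linP IHz !tens_assocE tens_mapE tconsE.
Qed.

(** Both sides satisfy the same recursion in the first letter, which always stays in the leftmost
    nonempty factor. *)
Lemma qs_coassoc x : tens_map Delta idfun (Delta x) =
  tens_assoc _ _ _ (tens_map idfun Delta (Delta x)).
Proof.
elim/tmod_ind: x => [|d s x IH]; first by rewrite !linear0.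
rewrite !linP IH; congr (_ *: _ + _) => {x IH}.
elim: s => [|a s IH].
  by rewrite -/one qs_coproduct1 !tens_mapE qs_coproduct1 tens_assocE.
rewrite -wconsE qs_coproduct_wcons !linearD tens_map_coproduct_tcons IH.
rewrite tens_assoc_tcons !tens_mapE qs_coproduct1 qs_coproduct_wcons.
by rewrite tensDr linearD tens_assocE addrA.
Qed.

Lemma qs_counitl x : tens_unitl _ (tens_map eps idfun (Delta x)) = x.
Proof.
have eps0 a (u : QS ⊗ QS) : tens_map eps idfun (tcons a u) = 0.
  elim/tens_ind: u => [|d y z u IH]; first by rewrite !linear0.
  by rewrite !linP IH tconsE tens_mapE qs_counit_wcons tens0l scaler0 addr0.
elim/tmod_ind: x => [|d s x IH]; first by rewrite !linear0.
rewrite !linP IH; congr (_ *: _ + _) => {x IH}.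
case: s => [|a s].
  by rewrite -/one qs_coproduct1 tens_mapE tens_unitlE qs_counit1 scale1r.
rewrite -wconsE qs_coproduct_wcons linearD eps0 addr0.
by rewrite tens_mapE tens_unitlE qs_counit1 scale1r.
Qed.

Lemma qs_counitr x : tens_unitr _ (tens_map idfun eps (Delta x)) = x.
Proof.
have epsr a (u : QS ⊗ QS) : tens_unitr _ (tens_map idfun eps (tcons a u)) =
    wcons a (tens_unitr _ (tens_map idfun eps u)).
  elim/tens_ind: u => [|d y z u IH]; first by rewrite !linear0.
  rewrite !linP IH; congr (_ *: _ + _).
  by rewrite tconsE !tens_mapE !tens_unitrE linearZ.
elim/tmod_ind: x => [|d s x IH]; first by rewrite !linear0.
rewrite !linP IH; congr (_ *: _ + _) => {x IH}.
elim: s => [|a s IH].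
  by rewrite -/one qs_coproduct1 tens_mapE tens_unitrE qs_counit1 scale1r.
rewrite -wconsE qs_coproduct_wcons !linearD epsr IH.
by rewrite tens_mapE tens_unitrE qs_counit_wcons scale0r add0r.
Qed.

(** * Multiplicativity of the coproduct *)

Lemma tens_mul_1tcons x b v :
  tens_mul mu (one ⊗ x) (tcons b v) = tcons b (tens_mul mu (one ⊗ x) v).
Proof.
elim/tens_ind: v => [|d y z v IH]; first by rewrite !(linear0, tens_mul0r).
rewrite !linP !tens_mulPr linP IH; congr (_ *: _ + _).
by rewrite !(tconsE, tens_mulE) !qs_1mul.
Qed.

Lemma tens_mul_tcons1 a u y :
  tens_mul mu (tcons a u) (one ⊗ y) = tcons a (tens_mul mu u (one ⊗ y)).
Proof.
elim/tens_ind: u => [|d x z u IH]; first by rewrite !(linear0, tens_mul0l).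
rewrite !linP !tens_mulPl linP IH; congr (_ *: _ + _).
by rewrite !(tconsE, tens_mulE) !qs_mul1.
Qed.

(** The quasi-shuffle recursion takes place in the left factor; the right factors are multiplied
    alike in all terms. *)
Lemma tens_mul_tcons a u b v : tens_mul mu (tcons a u) (tcons b v) =
  tcons a (tens_mul mu u (tcons b v)) + tcons b (tens_mul mu (tcons a u) v)
    + tcons (a * b) (tens_mul mu u v).
Proof.
elim/tens_ind: u => [|d x x' u IH].
  by rewrite !(linear0, tens_mul0l) !addr0.
rewrite !linP !tens_mulPl !linP IH -scale_add3; congr (_ *: _ + _) => {IH}.
elim/tens_ind: v => [|e y y' v IH].
  by rewrite !(linear0, tens_mul0r) !addr0.
rewrite !linP !tens_mulPr !linP IH -scale_add3; congr (_ *: _ + _).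
by rewrite !(tconsE, tens_mulE) qs_mul_wcons !tensDl.
Qed.

Lemma qs_coproduct_mul x y :
  Delta (x ⋆ y) = tens_mul mu (Delta x) (Delta y).
Proof.
elim/tmod_ind: x => [|d s x IH]; first by rewrite qs0l !linear0 tens_mul0l.
rewrite qsPl !linP tens_mulPl IH; congr (_ *: _ + _) => {d x IH}.
elim/tmod_ind: y => [|d t y IH]; first by rewrite qs0r !linear0 tens_mul0r.
rewrite qsPr !linP tens_mulPr IH; congr (_ *: _ + _) => {d y IH}.
have mul1 u : tens_mul mu (one ⊗ one) u = u.
  elim/tens_ind: u => [|d x y u IH]; first by rewrite tens_mul0r.
  by rewrite tens_mulPr IH tens_mulE !qs_1mul.
have mul1r u : tens_mul mu u (one ⊗ one) = u.
  elim/tens_ind: u => [|d x y u IH]; first by rewrite tens_mul0l.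
  by rewrite tens_mulPl IH tens_mulE !qs_mul1.
elim: s t => [|a s IHs] t.
  by rewrite -/one qs_coproduct1 qs_1mul mul1.
elim: t => [|b t IHt].
  by rewrite -/one qs_coproduct1 qs_mul1 mul1r.
have := IHs (b :: t); move: IHt (IHs t); rewrite -!wconsE => IHt IHst IHs'.
rewrite qs_mul_wcons !linearD !qs_coproduct_wcons IHs' IHt IHst.
rewrite !tens_mul_addl !tens_mul_addr tens_mulE qs_1mul qs_mul_wcons !tensDr.
rewrite tens_mul_1tcons tens_mul_tcons1 tens_mul_tcons.
rewrite !qs_coproduct_wcons !tens_mul_addl !tens_mul_addr !linearD.
(* Terms 1, 4, 7 form the product of the two [one ⊗ _] parts, 5 and 2 are the mixed products, and 3,
   6, 8 form the product of the two [tcons] parts. *)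
by rewrite (AC ((1*2)*(1*2)*2) ((1*4*7)*5*(2*(3*6*8)))).
Qed.

Lemma qs_bialgebra : is_bialgebra mu one Delta eps.
Proof.
split; [exact: qs_mulA | exact: qs_1mul | exact: qs_mul1 | exact: qs_coassoc
  | exact: qs_counitl | exact: qs_counitr | exact: qs_coproduct_mul
  | exact: qs_coproduct1 | exact: qs_counit_mul | exact: qs_counit1].
Qed.

(** * Convolution of functions on words *)

Local Notation words := (@word k Ar).
Implicit Types (f g h : seq Ar -> QS).

(* The functions need not be multilinear, hence need not factor through [QS]. *)
Definition conv f g s : QS :=
  \sum_(i < (size s).+1) f (take i s) ⋆ g (drop i s).

Lemma conv_nil f g : conv f g [::] = f [::] ⋆ g [::].
Proof. by rewrite /conv big_ord1. Qed.

Lemma conv_cons f g a s :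
  conv f g (a :: s) = f [::] ⋆ g (a :: s) + conv (fun t => f (a :: t)) g s.
Proof. by rewrite /conv big_ord_recl. Qed.

(** Only suffixes of [s] reach [g]; the bound on their length serves inductions on length. *)
Lemma eq_conv f f' g g' s : f =1 f' ->
  (forall t, size t <= size s -> g t = g' t) -> conv f g s = conv f' g' s.
Proof.
move=> ff' gg'; apply: eq_bigr => i _; rewrite ff' gg' // size_drop.
exact: leq_subr.
Qed.

Lemma conv_addl f f' g s :
  conv (fun t => f t + f' t) g s = conv f g s + conv f' g s.
Proof. by rewrite -big_split; apply: eq_bigr => i _; rewrite qsDl. Qed.

Lemma conv_mull x f g s : conv (fun t => x ⋆ f t) g s = x ⋆ conv f g s.
Proof.
rewrite (big_morph (fun y => x ⋆ y) (qsDr x) (qs0r x)).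
by apply: eq_bigr => i _; rewrite qs_mulA.
Qed.

Lemma conv_oppl f g s : conv (fun t => - f t) g s = - conv f g s.
Proof.
rewrite (big_morph -%R (@opprD _) (oppr0 _)); apply: eq_bigr => i _.
by apply: (addrI (f (take i s) ⋆ g (drop i s))); rewrite -qsDl !subrr qs0l.
Qed.

Lemma convA f g h s : conv f (conv g h) s = conv (conv f g) h s.
Proof.
(* [f] is generalised because [conv_cons] replaces it by [fun t => f (a :: t)]. *)
elim: s f => [|a s IH] f; first by rewrite !conv_nil qs_mulA.
rewrite !conv_cons IH conv_nil qsDr qs_mulA -addrA; congr (_ + _).
rewrite -conv_mull -conv_addl; apply: eq_conv => // t.
by rewrite conv_cons.
Qed.

Definition conv_unit s : QS := (nilp s)%:R *: one.

Lemma conv1l f s : conv conv_unit f s = f s.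
Proof.
case: s => [|a s]; first by rewrite conv_nil /conv_unit scale1r qs_1mul.
rewrite conv_cons /conv_unit scale1r qs_1mul /= /conv big1 ?addr0 // => i _.
by rewrite scale0r qs0l.
Qed.

Lemma conv1r f s : conv f conv_unit s = f s.
Proof.
elim: s f => [|a s IH] f; first by rewrite conv_nil /conv_unit scale1r qs_mul1.
by rewrite conv_cons IH /conv_unit scale0r qs0r add0r.
Qed.

(* A left convolution inverse is also a right one: [conv f _] determines the
   value at [s] from the values at proper suffixes of [s]. *)
Lemma conv_left_inverse_right f g : f [::] = one ->
  conv f g =1 conv_unit -> conv g f =1 conv_unit.
Proof.
move=> f1 fg s; move: {2}(size s) (leqnn (size s)) => n.
elim: n s => [|n IH] s le_sn.
  move: le_sn (fg s); case: s => // _; rewrite !conv_nil f1 => <-.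
  by rewrite qs_mul1 qs_1mul.
(* Associativity turns the left side into the convolution of [conv f g], the unit, with [f]. *)
have E : conv f (conv g f) s = conv f conv_unit s.
  by rewrite convA conv1r -[RHS]conv1l; apply: eq_conv.
case: s le_sn E => [|a s] le_sn; first by move=> _; apply: IH.
rewrite !conv_cons f1 !qs_1mul.
rewrite (@eq_conv _ (fun t => f (a :: t)) (conv g f) conv_unit) //.
  by move/addIr.
by move=> t le_ts; apply: IH; apply: leq_trans le_ts _.
Qed.

(** * The antipode on words *)

(* [merges a s] is the sum of [L ∘ (a :: s)] over all compositions [L]: either
   the first block is [a] alone, or the next letter is multiplied into it. *)
Fixpoint merges a s : QS :=
  if s is b :: s' then wcons a (merges b s') + merges (a * b) s'
  else wcons a one.

Definition coarsenings s : QS := if s is a :: s' then merges a s' else one.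

(* The part of [merges a p ⋆ word t] whose first letter comes from [merges a p]. *)
Fixpoint merges_first a p t : QS :=
  if p is b :: p' then
    wcons a (merges b p' ⋆ word t) + merges_first (a * b) p' t
  else wcons a (word t).

Lemma merges_first_nil a p : merges_first a p [::] = merges a p.
Proof.
by elim: p a => [|b p IH] a //=; rewrite -/one qs_mul1 IH.
Qed.

Lemma merges_mul_cons a p c t : merges a p ⋆ word (c :: t) =
  merges_first a p (c :: t) + merges_first c (a :: p) t.
Proof.
elim: p a c => [|b p IH] a c /=.
  rewrite -wconsE qs_mul_wcons !qs_1mul (mulrC a); exact: esym (addrA _ _ _).
rewrite qsDl IH -wconsE qs_mul_wcons wconsE /= qsDl linearD (mulrC a c) mulrA.
by rewrite (AC (3*(1*2)) ((1*4)*((2*5)*(3*6)))).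
Qed.

Definition qs_anti s : QS := (-1) ^+ size s *: coarsenings (rev s).

(* The alternating sum telescopes: [merges_mul_cons] splits each term into two
   parts, the second of which cancels against the rest of the sum. *)
Lemma conv_coarsenings a p s :
  conv (fun t => (-1) ^+ size t *: coarsenings (rev t ++ a :: p)) words s =
  merges_first a p s.
Proof.
elim: s a p => [|c s IH] a p.
  by rewrite conv_nil scale1r qs_mul1 merges_first_nil.
rewrite conv_cons scale1r [coarsenings _]/= merges_mul_cons -IH.
rewrite -[RHS]addr0 -addrA; congr (_ + _).
apply/eqP; rewrite addrC addr_eq0 -conv_oppl; apply/eqP/eq_conv => // t.
by rewrite rev_cons cat_rcons exprS mulN1r scaleNr.
Qed.

Lemma conv_qs_antil : conv qs_anti words =1 conv_unit.
Proof.
case=> [|a s]; first by rewrite conv_nil qs_mul1.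
rewrite conv_cons {1}/qs_anti scale1r qs_1mul /conv_unit scale0r.
(* [word (a :: s)] is [merges_first a [::] s], an alternating sum by [conv_coarsenings]; the
   remaining sum is its opposite, as each prefix there has the additional letter [a]. *)
apply/eqP; rewrite addrC addr_eq0 -wconsE -/(merges_first a [::] s).
rewrite -conv_coarsenings -conv_oppl; apply/eqP/eq_conv => // t.
by rewrite /qs_anti rev_cons -cats1 exprS mulN1r scaleNr.
Qed.

Lemma conv_qs_antir : conv words qs_anti =1 conv_unit.
Proof.
apply: conv_left_inverse_right conv_qs_antil.
by rewrite /qs_anti scale1r.
Qed.

(** * Extension of the antipode to the whole module *)

Lemma mergesPl d a b s :
  merges (d *: a + b) s = d *: merges a s + merges b s.
Proof.
elim: s a b => [|c s IH] a b /=; first exact: wconsP.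
by rewrite wconsP mulrDl -alg_scaleAl IH addrACA -scalerDr.
Qed.

Lemma merges_multilinear a : multilinear (merges a).
Proof.
move=> d s b c t; elim: s a => [|e s IH] a /=.
  (* Commutativity of [A] brings the linear combination to the left of the product, where [mulrDl]
     and [alg_scaleAl] apply. *)
  by rewrite mergesPl linP mulrC mulrDl -alg_scaleAl mergesPl !(mulrC a)
    addrACA -scalerDr.
by rewrite !IH linP addrACA -scalerDr.
Qed.

Lemma coarsenings_multilinear : multilinear coarsenings.
Proof.
by move=> d [|e s] b c t; [exact: mergesPl | exact: merges_multilinear].
Qed.

Fact qs_anti_multilinear : multilinear qs_anti.
Proof.
move=> d s b c t; rewrite /qs_anti !rev_cat !rev_cons !cat_rcons.
rewrite coarsenings_multilinear !size_cat /=.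
by rewrite scalerDr !scalerA mulrC.
Qed.

Definition qs_antipode : {linear QS -> QS} := word_lift qs_anti_multilinear.

Lemma qs_antipodeE s : qs_antipode (word s) = qs_anti s.
Proof. exact: word_liftE. Qed.

(** Passes from words to the module: both sides are linear in [x], and on a word the left side is a
    convolution. *)
Lemma conv_linear (f g : {linear QS -> QS}) x :
  conv (f \o words) (g \o words) =1 conv_unit ->
  mu (tens_map f g (Delta x)) = (eps x : k) *: one.
Proof.
move=> fg; elim/tmod_ind: x => [|d s x IH].
  by rewrite !linear0 scale0r.
rewrite !linP IH -[RHS]/((d * (eps (word s) : k) + (eps x : k)) *: one).
rewrite scalerDl -scalerA; congr (_ *: _ + _).
rewrite counitE -[RHS]/(conv_unit s) -fg coproductE !linear_sum.
by apply: eq_bigr => i _; rewrite tens_mapE.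
Qed.

Lemma qs_antipode_is_antipode : is_antipode mu one Delta eps qs_antipode.
Proof.
move=> x; split; apply: conv_linear => s.
  rewrite -conv_qs_antil; apply: eq_conv => // t.
  exact: qs_antipodeE.
rewrite -conv_qs_antir; apply: eq_conv => // t _; exact: qs_antipodeE.
Qed.

(** * Identification with the sum over compositions *)

(** The empty list is a default case: a composition of a positive number has a head. *)
Definition incr_head (L : seq nat) : seq nat :=
  if L is l :: L' then l.+1 :: L' else [::].

Lemma compositions0 : perm_eq (compositions 0) [:: [::]].
Proof.
apply: uniq_perm => // [|[|[|l] L]]; first exact: uniq_compositions.
all: by rewrite mem_compositions /is_composition /= ?addSn ?andbF.
Qed.

Lemma compositions1 : perm_eq (compositions 1) [:: [:: 1%N]].
Proof.
apply: uniq_perm => // [|L]; first exact: uniq_compositions.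
rewrite mem_compositions inE /is_composition.
case: L => [|[|[|l]] [|[|m] L]] //=.
all: by rewrite ?addnS ?addSn ?andbF.
Qed.

(** A first part 1 is split off and a larger one is lowered by 1, matching the two branches of
    [merges]. The total 1 is treated apart because the composition of 0 has no head to raise. *)
Lemma compositionsSS n : perm_eq (compositions n.+2)
  (map (cons 1%N) (compositions n.+1) ++ map incr_head (compositions n.+1)).
Proof.
have incr_inj : injective incr_head.
  by move=> [|l L] [|m M] //= [-> ->].
have cons_inj : injective (cons 1%N) by move=> L M [].
apply: uniq_perm => [||L]; first exact: uniq_compositions.
  (* The two lists are disjoint: heads are 1 in the first and, parts being positive, at least 2 in
     the second. *)
  rewrite cat_uniq !map_inj_uniq ?uniq_compositions // andbT.
  apply/hasPn => L /mapP[M]; rewrite mem_compositions => M_comp ->.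
  apply/mapP => -[N _]; case: M M_comp => [|[|m] M] //=.
rewrite mem_cat mem_compositions.
case: L => [|[|[|l]] L].
- by apply/esym/orP => -[] /mapP[] // [|? ?] //; rewrite mem_compositions.
- by apply/esym/orP => -[] /mapP[] // [|[|?] ?] //; rewrite mem_compositions.
- rewrite (mem_map cons_inj) mem_compositions.
  have -> : (1%N :: L \in map incr_head (compositions n.+1)) = false.
    by apply/negP => /mapP[[|[|?] ?]] //; rewrite mem_compositions.
  by rewrite orbF.
- have -> : (l.+2 :: L \in map (cons 1%N) (compositions n.+1)) = false.
    by apply/negP => /mapP[].
  rewrite -[l.+2 :: L]/(incr_head (l.+1 :: L)) (mem_map incr_inj).
  by rewrite mem_compositions.
Qed.

(** Positivity of the first part puts [b] in the first block, so raising that part makes [a] and [b]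
    share a block. *)
Lemma comp_act_incr_head (L : seq nat) a b s : all (leq 1) L ->
  comp_act (incr_head L) (a :: b :: s) = comp_act L (a * b :: s).
Proof.
by case: L => [|[|l] L] //= _; rewrite /comp_act /= !big_cons mulrA.
Qed.

(** The two halves of [compositionsSS] yield the two summands in the recursion of [merges]. *)
Lemma sum_compositions s :
  \sum_(L <- compositions (size s)) word (comp_act L s) = coarsenings s.
Proof.
case: s => [|a s].
  by rewrite (perm_big _ compositions0) big_seq1.
elim: s a => [|b s IH] a.
  rewrite (perm_big _ compositions1) big_seq1 /comp_act /= big_seq1.
  by rewrite -wconsE.
rewrite (perm_big _ (compositionsSS _)) big_cat !big_map /=.
rewrite -[merges b s]/(coarsenings (b :: s)).
rewrite -[merges (a * b) s]/(coarsenings (a * b :: s)) -!IH.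
congr (_ + _).
  rewrite linear_sum; apply: eq_bigr => L _.
  by rewrite wconsE /comp_act /= big_seq1.
apply: eq_big_seq => L; rewrite mem_compositions => /andP[L_gt0 _].
by rewrite comp_act_incr_head.
Qed.

End QuasiShuffleBialgebra.

Theorem theorem3p3 (k : comNzRingType) (ratk : {rmorphism rat -> k})
    (A : comPzRingType) (rho : {rmorphism k -> A}) :
  exists S : {linear QS rho -> QS rho},
    is_hopf_algebra (qs_mul rho) (qs_one rho) (qs_coproduct rho)
      (qs_counit rho) S /\
    forall a : seq A,
      S (pure_tensor rho a) =
        (-1) ^+ size a *:
          \sum_(L <- compositions (size a)) pure_tensor rho (comp_act L (rev a)).
Proof.
exists (qs_antipode rho); split.
  split; [exact: qs_bialgebra | exact: qs_antipode_is_antipode].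
move=> a; rewrite /pure_tensor qs_antipodeE /qs_anti -sum_compositions.
by rewrite size_rev.
Qed.
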